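(* The symmetric synthesis problem for architecture S0 is undecidable: there is no algorithm that, given an LTL formula $\varphi$ over the propositions $\{x,y,z\}$, decides whether there exists a finite-state Moore machine with input proposition set $\{a\}$ and output proposition set $\{b\}$ such that the system obtained by plugging it into both processes of S0 satisfies $\varphi$.
   Context: A symmetric architecture over a process interface $(\mathsf{AP}^I,\mathsf{AP}^O)$ consists of internal signals $S$, processes $P$, global inputs $\mathsf{AP}^I_G$, an input edge function $E^{in}:P\times\mathsf{AP}^I\to S\cup\mathsf{AP}^I_G$ and an output edge function $E^{out}:P\times\mathsf{AP}^O\to S$; every internal signal is written by exactly one process output. Plugging a Moore machine $(Q,2^{\mathsf{AP}^I},2^{\mathsf{AP}^O},\delta,q_0,L)$ into all processes yields the synchronous composition with states $P\to Q$, initial state $p\mapsto q_0$; in a state $f$ the signal $s$ is true iff $s=E^{out}(p,o)$ for some $o\in L(f(p))$; on global input $X\subseteq\mathsf{AP}^I_G$ each process $p$ moves to $\delta(f(p),\{i\in\mathsf{AP}^I\mid E^{in}(p,i)\in X\cup(\text{current true signals})\})$. The system satisfies $\varphi$ if for every infinite global input sequence, the trace whose $k$-th letter is the $k$-th global input together with the signals true in the $k$-th state satisfies $\varphi$. Architecture S0: interface $(\{a\},\{b\})$, processes $\{0,1\}$, global inputs $\{x\}$, internal signals $\{y,z\}$, $E^{in}(0,a)=x$, $E^{in}(1,a)=y$, $E^{out}(0,b)=y$, $E^{out}(1,b)=z$. *)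

(* Defs.v *)
From HB Require Import structures.
From mathcomp Require Import all_boot.

Set Implicit Arguments.
Unset Strict Implicit.
Unset Printing Implicit Defensive.

Inductive ltl (AP : Type) : Type :=
| LTrue
| LAtom of AP
| LNot of ltl AP
| LAnd of ltl AP & ltl AP
| LNext of ltl AP
| LUntil of ltl AP & ltl AP.

Arguments LTrue {AP}.

Definition word (AP : Type) := nat -> AP -> Prop.

Fixpoint sat_at (AP : Type) (w : word AP) (i : nat) (f : ltl AP) : Prop :=
  match f with
  | LTrue => True
  | LAtom p => w i p
  | LNot g => ~ sat_at w i g
  | LAnd g h => sat_at w i g /\ sat_at w i h
  | LNext g => sat_at w i.+1 g
  | LUntil g h =>
      exists2 j, i <= j &
        (sat_at w j h /\ forall k, i <= k -> k < j -> sat_at w k g)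
  end.

Definition ltl_sat (AP : Type) (w : word AP) (f : ltl AP) := sat_at w 0 f.

(* Letters of 2^I are represented as characteristic functions I->bool.*)

Record moore (I O : Type) := Moore {
  mstate : finType;
  mdelta : mstate -> (I -> bool) -> mstate;
  minit  : mstate;
  mout   : mstate -> O -> bool
}.

Record sym_arch (API APO : Type) := SymArch {
  sig_t  : eqType;
  proc_t : finType;
  gin_t  : Type;
  e_in   : proc_t -> API -> sig_t + gin_t;
  e_out  : proc_t -> APO -> sig_t
}.

Section Composition.
Variables (API : Type) (APO : finType) (A : sym_arch API APO) (M : moore API APO).

Definition cstate := proc_t A -> mstate M.

Definition cinit : cstate := fun _ => minit M.

Definition sig_true (f : cstate) (s : sig_t A) : bool :=
  [exists p, [exists o, (e_out p o == s) && mout (f p) o]].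

Definition cstep (f : cstate) (X : gin_t A -> bool) : cstate :=
  fun p => mdelta (f p) (fun i =>
     match e_in p i with
     | inl s => sig_true f s
     | inr g => X g
     end).

Fixpoint cstates (inp : nat -> gin_t A -> bool) (k : nat) : cstate :=
  match k with
  | 0 => cinit
  | k'.+1 => cstep (cstates inp k') (inp k')
  end.

Definition ctrace (inp : nat -> gin_t A -> bool) : word (sig_t A + gin_t A) :=
  fun k a => match a with
             | inl s => sig_true (cstates inp k) s
             | inr g => inp k g
             end.

Definition sys_satisfies (phi : ltl (sig_t A + gin_t A)) : Prop :=
  forall inp : nat -> gin_t A -> bool, ltl_sat (ctrace inp) phi.

End Composition.

(* interface ({a},{b}) : both singletons, represented by unit          *)
(* processes {0,1} = 'I_2, global inputs {x} = unit, signals {y,z}     *)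

Inductive sig0 := sy | sz.
Definition sig0_eqb (s t : sig0) : bool :=
  match s, t with sy, sy | sz, sz => true | _, _ => false end.
Lemma sig0_eqP : Equality.axiom sig0_eqb.
Proof. by case; case; constructor. Qed.
HB.instance Definition _ := hasDecEq.Build sig0 sig0_eqP.

Definition S0_ein (p : 'I_2) (_ : unit) : sig0 + unit :=
  if val p == 0 then inr tt
  else inl sy.

Definition S0_eout (p : 'I_2) (_ : unit) : sig0 :=
  if val p == 0 then sy
  else sz.

Definition S0 : sym_arch unit unit :=
  @SymArch unit unit sig0 ('I_2 : finType) unit S0_ein S0_eout.

Inductive prop_xyz := px | py | pz.

Definition xyz_to_S0 (q : prop_xyz) : sig_t S0 + gin_t S0 :=
  match q with px => inr tt | py => inl sy | pz => inl sz end.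

Fixpoint ltl_map (A B : Type) (m : A -> B) (f : ltl A) : ltl B :=
  match f with
  | LTrue => LTrue
  | LAtom p => LAtom (m p)
  | LNot g => LNot (ltl_map m g)
  | LAnd g h => LAnd (ltl_map m g) (ltl_map m h)
  | LNext g => LNext (ltl_map m g)
  | LUntil g h => LUntil (ltl_map m g) (ltl_map m h)
  end.

Definition S0_realizable (phi : ltl prop_xyz) : Prop :=
  exists M : moore unit unit, @sys_satisfies unit unit S0 M (ltl_map xyz_to_S0 phi).

Inductive instr :=
| Inc of nat
| Dec of nat & nat.

Definition program := seq instr.

Definition config := (nat * (nat -> nat))%type.

Definition halted (P : program) (c : config) : bool := size P <= c.1.

Definition upd (regs : nat -> nat) (r v : nat) : nat -> nat :=
  fun r' => if r' == r then v else regs r'.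

Definition step (P : program) (c : config) : config :=
  let: (pc, regs) := c in
  match nth (Inc 0) P pc with
  | Inc r => if halted P c then c else (pc.+1, upd regs r (regs r).+1)
  | Dec r j =>
      if halted P c then c
      else if regs r == 0 then (j, regs) else (pc.+1, upd regs r (regs r).-1)
  end.

Definition init_config (n : nat) : config := (0, fun r => if r == 0 then n else 0).

Definition computes_on (P : program) (n m : nat) : Prop :=
  exists t, let c := iter t (step P) (init_config n) in halted P c /\ c.2 0 = m.

(* Goedel numbering of LTL formulas over {x,y,z} (Cantor pairing).     *)

Definition cpair (a b : nat) : nat := ((a + b) * (a + b).+1)./2 + b.

Definition code_xyz (q : prop_xyz) : nat :=
  match q with px => 0 | py => 1 | pz => 2 end.

Fixpoint code_ltl (f : ltl prop_xyz) : nat :=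
  match f with
  | LTrue => cpair 0 0
  | LAtom q => cpair 1 (code_xyz q)
  | LNot g => cpair 2 (code_ltl g)
  | LAnd g h => cpair 3 (cpair (code_ltl g) (code_ltl h))
  | LNext g => cpair 4 (code_ltl g)
  | LUntil g h => cpair 5 (cpair (code_ltl g) (code_ltl h))
  end.

Definition ltl_decidable (Q : ltl prop_xyz -> Prop) : Prop :=
  exists P : program, forall phi,
    (Q phi -> computes_on P (code_ltl phi) 1) /\
    (~ Q phi -> computes_on P (code_ltl phi) 0).

(* Main.v *)
Require Import Defs.
From Stdlib Require Import Classical FunctionalExtensionality.
From mathcomp Require Import all_boot zify.

(** If [F] is the causal map computed by the Moore machine, the traces of S0 are the triples
    (x, F x, F (F x)). A formula can force F to answer an input 0^s 1^(i+1) 0 ... by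
    0^(s+2) 1^i 0 w_i with w_i independent of s and of the rest of the input: the word y = F x is
    itself an input with a smaller counter, so F y contains w_(i-1) one step behind w_i in y, and an
    LTL formula comparing y with the next letter of z = F y can require w_0 to encode the initial
    configuration of a counter machine and w_i to encode the successor of the configuration encoded
    by w_(i-1). A finite-state F exists when the run becomes stationary, and no F exists when the run
    leaves the program. Given a decision procedure, take for the counter machine a program that
    computes the code of the formula itself, runs the procedure on it, and leaves the program exactly
    if the answer is positive. For the self-reference the formula is a conjunction of a part B that
    describes the program and a part A_n saying that the input register is n: the machine on input n
    computes the code of the conjunction of A_n and the formula coded by n, and n is the code of B. *)

Set Implicit Arguments.
Unset Strict Implicit.
Unset Printing Implicit Defensive.

(** * Counter machines with explicit jump targets *)

Record minstr := MI { mi_inc : bool; mi_reg : nat; mi_next : nat; mi_zero : nat }.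

Definition mi_dflt := MI false 0 0 0.

Definition mi_step (i : minstr) (rho : nat -> nat) : config :=
  let: MI b r q1 q0 := i in
  (if rho r == 0 then q0 else q1, upd rho r (if b then (rho r).+1 else (rho r).-1)).

Definition mstep (D : seq minstr) (c : config) : config :=
  let: (q, rho) := c in
  if q < size D then mi_step (nth mi_dflt D q) rho else c.

Definition reach (D : seq minstr) (c c' : config) : Prop :=
  exists t, iter t (mstep D) c = c'.

Definition code_at (D : seq minstr) (off : nat) (s : seq minstr) : Prop :=
  exists a b, D = a ++ s ++ b /\ size a = off.

Lemma updE (rho : nat -> nat) r v r' :
  upd rho r v r' = if r' == r then v else rho r'.
Proof. by []. Qed.

Lemma upd_id (rho : nat -> nat) r v : rho r = v -> upd rho r v = rho.
Proof.
by move=> <-; apply: functional_extensionality => r'; rewrite /upd; case: eqP => // ->.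
Qed.

Lemma reach_refl D c : reach D c c.
Proof. by exists 0. Qed.

Lemma reach_trans D c1 c2 c3 : reach D c1 c2 -> reach D c2 c3 -> reach D c1 c3.
Proof. by move=> [t <-] [u <-]; exists (u + t); rewrite iterD. Qed.

Lemma reach_step D c c' : reach D (mstep D c) c' -> reach D c c'.
Proof. by move=> [t <-]; exists t.+1; rewrite iterSr. Qed.

Lemma code_at_cat D off s1 s2 :
  code_at D off (s1 ++ s2) -> code_at D off s1 /\ code_at D (off + size s1) s2.
Proof.
move=> [a [b [-> <-]]]; split; first by exists a, (s2 ++ b); rewrite !catA.
by exists (a ++ s1), b; rewrite size_cat !catA.
Qed.

Lemma code_at_nth D off s k : code_at D off s -> k < size s ->
  nth mi_dflt D (off + k) = nth mi_dflt s k /\ off + k < size D.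
Proof.
move=> [a [b [-> <-]]] lt_k; split; last by rewrite !size_cat; lia.
rewrite nth_cat ifF; last by lia.
by rewrite addKn nth_cat lt_k.
Qed.

Lemma code_at_head D off i s : code_at D off (i :: s) ->
  nth mi_dflt D off = i /\ off < size D.
Proof. by move=> /(@code_at_nth _ _ _ 0) /= /(_ isT); rewrite addn0. Qed.

Lemma mstepE D q rho b r q1 q0 :
  nth mi_dflt D q = MI b r q1 q0 -> q < size D ->
  mstep D (q, rho) = (if rho r == 0 then q0 else q1,
                      upd rho r (if b then (rho r).+1 else (rho r).-1)).
Proof. by rewrite /mstep => -> ->. Qed.

(** * A structured language and its compilation *)

Inductive cmd := CSkip | CInc of nat | CSeq of cmd & cmd | CLoop of nat & cmd.

Inductive exec : cmd -> (nat -> nat) -> (nat -> nat) -> Prop :=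
| ExSkip rho : exec CSkip rho rho
| ExInc r rho : exec (CInc r) rho (upd rho r (rho r).+1)
| ExSeq c1 c2 rho1 rho2 rho3 :
    exec c1 rho1 rho2 -> exec c2 rho2 rho3 -> exec (CSeq c1 c2) rho1 rho3
| ExLoop0 r c rho : rho r = 0 -> exec (CLoop r c) rho rho
| ExLoopS r c v rho1 rho2 rho3 : rho1 r = v.+1 ->
    exec c (upd rho1 r v) rho2 -> exec (CLoop r c) rho2 rho3 ->
    exec (CLoop r c) rho1 rho3.

Fixpoint csize (c : cmd) : nat :=
  match c with
  | CSkip => 0
  | CInc _ => 1
  | CSeq c1 c2 => csize c1 + csize c2
  | CLoop _ c => (csize c).+2
  end.

(* The machine has no unconditional jump: the loop test is repeated at the end of the body. *)
Fixpoint compile (off : nat) (c : cmd) : seq minstr :=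
  match c with
  | CSkip => [::]
  | CInc r => [:: MI true r off.+1 off.+1]
  | CSeq c1 c2 => compile off c1 ++ compile (off + csize c1) c2
  | CLoop r c =>
      let test := MI false r off.+1 (off + (csize c).+2) in
      test :: compile off.+1 c ++ [:: test]
  end.

Lemma size_compile off c : size (compile off c) = csize c.
Proof.
elim: c off => //= [c1 IH1 c2 IH2|r c IH] off; first by rewrite size_cat IH1 IH2.
by rewrite size_cat IH addn1.
Qed.

Lemma compile_correct D c rho rho' off :
  exec c rho rho' -> code_at D off (compile off c) ->
  reach D (off, rho) (off + csize c, rho').
Proof.
move=> ex cD.
(* After a pass through its body a loop resumes at the second copy of the test, so the induction
   must also cover entry there. *)
suff [] : reach D (off, rho) (off + csize c, rho') /\
  (if c is CLoop _ c0 then reach D (off + (csize c0).+1, rho) (off + csize c, rho')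
   else True) by [].
elim: ex off cD => {c rho rho'} //=.
- by move=> rho off _; rewrite addn0; split; [exact: reach_refl|].
- move=> r rho off /code_at_head [e lt]; split=> //.
  by exists 1; rewrite /= lt e addn1 /= if_same.
- move=> c1 c2 rho1 rho2 rho3 _ IH1 _ IH2 off /code_at_cat [/IH1 [r1 _]].
  rewrite size_compile => /IH2 [r2 _]; split=> //.
  by rewrite addnA; apply: reach_trans r1 r2.
- move=> r c rho r0 off cD.
  have [e lt] := code_at_head cD.
  have /code_at_nth -/(_ (csize c).+1) := cD.
  rewrite /= size_cat size_compile addn1 => /(_ (ltnSn _)) [].
  rewrite nth_cat size_compile ltnn subnn /= => e' lt'.
  by split; exists 1; [rewrite /= lt e|rewrite /= lt' e'];
    rewrite /= r0 /= upd_id.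
- move=> r c v rho1 rho2 rho3 rv _ IH1 _ IH2 off cD.
  have [e lt] := code_at_head cD.
  have /code_at_nth -/(_ (csize c).+1) := cD.
  rewrite /= size_cat size_compile addn1 => /(_ (ltnSn _)) [].
  rewrite nth_cat size_compile ltnn subnn /= => e' lt'.
  have [_ r2] := IH2 _ cD.
  move: cD; rewrite -cat1s => /code_at_cat [_ /code_at_cat []].
  rewrite /= addn1 => /IH1 [r1 _] _.
  rewrite addSnnS in r1.
  by split; apply: reach_step;
    [rewrite (mstepE _ e lt)|rewrite (mstepE _ e' lt')];
    rewrite rv /=; apply: reach_trans r1 r2.
Qed.

(** A program may halt at any counter past its end; clamping the jump targets merges all these exits
    into the address [off + size P], where the next piece of code starts. *)
Definition relocate (P : program) (off : nat) : seq minstr :=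
  mkseq (fun k => match nth (Inc 0) P k with
                  | Inc r => MI true r (off + k.+1) (off + k.+1)
                  | Dec r j => MI false r (off + k.+1) (off + minn j (size P))
                  end) (size P).

Lemma relocate_correct D P off t c :
  code_at D off (relocate P off) -> halted P (iter t (step P) c) ->
  reach D (off + minn c.1 (size P), c.2)
          (off + size P, (iter t (step P) c).2).
Proof.
move=> cD; elim: t c => [|t IH] c.
  by rewrite /halted /= => /minn_idPr ->; apply: reach_refl.
rewrite iterSr => /IH; have [lt_c|ge_c] := ltnP c.1 (size P); last first.
  suff -> : step P c = c by rewrite (minn_idPr ge_c).
  by case: c ge_c => pc rho /= ge_c; rewrite /halted /= ge_c; case: nth.
case: c lt_c => pc rho lt_pc re.
apply: reach_step.
have {lt_pc}lt_pc : pc < size P := lt_pc.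
move: re; rewrite /halted [step _ _]/= [mstep _ _]/= /halted leqNgt lt_pc.
have /code_at_nth -/(_ pc) := cD; rewrite size_mkseq => /(_ lt_pc) [].
rewrite nth_mkseq // => e lt; rewrite lt e.
case: nth => [r|r j]; rewrite [mi_step _ _]/=.
  by rewrite [(_, _).1]/= (minn_idPl lt_pc) if_same.
case: eqP => [r0|_]; last by rewrite [(_, _).1]/= (minn_idPl lt_pc).
by rewrite upd_id // r0.
Qed.

(** * Computing the code of a formula *)

(** Register contents are written [nth 0 l], so that symbolic execution becomes computation on
    lists. *)
Lemma upd_nth l r v : upd (nth 0 l) r v = nth 0 (set_nth 0 l r v).
Proof. by apply: functional_extensionality => k; rewrite nth_set_nth. Qed.

Lemma exec_inc l r :
  exec (CInc r) (nth 0 l) (nth 0 (set_nth 0 l r (nth 0 l r).+1)).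
Proof. by rewrite -upd_nth; constructor. Qed.

Lemma exec_loopS l l' r c rho v : nth 0 l r = v.+1 ->
  exec c (nth 0 (set_nth 0 l r v)) (nth 0 l') ->
  exec (CLoop r c) (nth 0 l') rho -> exec (CLoop r c) (nth 0 l) rho.
Proof. by move=> e; rewrite -upd_nth; apply: ExLoopS. Qed.

Fixpoint incs (n r : nat) : cmd :=
  if n is n'.+1 then CSeq (CInc r) (incs n' r) else CSkip.

Lemma exec_incs1 n m u s t w k p :
  exec (incs n 1) (nth 0 [:: m; u; s; t; w; k; p])
                  (nth 0 [:: m; n + u; s; t; w; k; p]).
Proof.
elim: n u => [|n IH] u /=; first by constructor.
by apply: ExSeq (exec_inc _ _) _; rewrite addSnnS; apply: IH.
Qed.

Lemma exec_incs0 n m u s t w k p :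
  exec (incs n 0) (nth 0 [:: m; u; s; t; w; k; p])
                  (nth 0 [:: n + m; u; s; t; w; k; p]).
Proof.
elim: n m => [|n IH] m /=; first by constructor.
by apply: ExSeq (exec_inc _ _) _; rewrite addSnnS; apply: IH.
Qed.

(* Replaces register 0 by [cpair] of registers 1 and 0; registers 2 to 4 are scratch. *)
Definition pair_cmd : cmd :=
  CSeq (CLoop 1 (CInc 2))
  (CSeq (CLoop 0 (CSeq (CInc 2) (CInc 3)))
  (CSeq (CLoop 3 (CInc 0))
  (CLoop 2 (CSeq (CInc 0)
           (CSeq (CLoop 2 (CSeq (CInc 0) (CInc 4))) (CLoop 4 (CInc 2))))))).

(** The sum s = u + m is gathered in register 2 while m is restored in register 0. The last loop
    then adds s + (s - 1) + ... + 1, the triangular part of [cpair]; register 4 saves the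
    decremented s in each round. *)
Lemma exec_pair m u k p :
  exec pair_cmd (nth 0 [:: m; u; 0; 0; 0; k; p])
                (nth 0 [:: cpair u m; 0; 0; 0; 0; k; p]).
Proof.
have move12 s : exec (CLoop 1 (CInc 2)) (nth 0 [:: m; u; s; 0; 0; k; p])
                  (nth 0 [:: m; 0; u + s; 0; 0; k; p]).
  elim: u s => [|v IH] s; first by apply: ExLoop0.
  by apply: exec_loopS (exec_inc _ _) _ => //; rewrite addSnnS; apply: IH.
have move023 s t : exec (CLoop 0 (CSeq (CInc 2) (CInc 3)))
    (nth 0 [:: m; 0; s; t; 0; k; p]) (nth 0 [:: 0; 0; m + s; m + t; 0; k; p]).
  elim: m s t {move12} => [|v IH] s t; first by apply: ExLoop0.
  apply: exec_loopS (ExSeq (exec_inc _ _) (exec_inc _ _)) _ => //.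
  by rewrite !addSnnS; apply: IH.
have move30 s t a : exec (CLoop 3 (CInc 0))
    (nth 0 [:: a; 0; s; t; 0; k; p]) (nth 0 [:: t + a; 0; s; 0; 0; k; p]).
  elim: t a => [|v IH] a; first by apply: ExLoop0.
  by apply: exec_loopS (exec_inc _ _) _ => //; rewrite addSnnS; apply: IH.
have move204 a s w : exec (CLoop 2 (CSeq (CInc 0) (CInc 4)))
    (nth 0 [:: a; 0; s; 0; w; k; p]) (nth 0 [:: s + a; 0; 0; 0; s + w; k; p]).
  elim: s a w => [|v IH] a w; first by apply: ExLoop0.
  apply: exec_loopS (ExSeq (exec_inc _ _) (exec_inc _ _)) _ => //.
  by rewrite !addSnnS; apply: IH.
have move42 a s w : exec (CLoop 4 (CInc 2))
    (nth 0 [:: a; 0; s; 0; w; k; p]) (nth 0 [:: a; 0; w + s; 0; 0; k; p]).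
  elim: w s => [|v IH] s; first by apply: ExLoop0.
  by apply: exec_loopS (exec_inc _ _) _ => //; rewrite addSnnS; apply: IH.
apply: ExSeq (move12 0) _; apply: ExSeq (move023 _ 0) _.
apply: ExSeq (move30 _ _ 0) _; rewrite !addn0 /cpair [m + u]addnC.
move: (u + m) => s; elim: s m {move12 move023} => [|s IH] a; first by apply: ExLoop0.
apply: exec_loopS => //.
  apply: ExSeq (exec_inc _ _) _; apply: ExSeq (move204 _ _ _) (move42 _ _ _).
have -> : (s.+1 * s.+2)./2 + a = (s * s.+1)./2 + (s + a.+1).
  have -> : s.+1 * s.+2 = s * s.+1 + s.+1.*2 by rewrite -muln2; lia.
  by rewrite halfD odd_double andbF doubleK; lia.
by rewrite !addn0; apply: IH.
Qed.

Definition push_cmd (c : nat) : cmd := CSeq (incs c 1) pair_cmd.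

Lemma exec_push c m k p :
  exec (push_cmd c) (nth 0 [:: m; 0; 0; 0; 0; k; p])
                    (nth 0 [:: cpair c m; 0; 0; 0; 0; k; p]).
Proof. by apply: ExSeq (exec_incs1 _ _ _ _ _ _ _ _) _; rewrite addn0; apply: exec_pair. Qed.

Definition pushes_cmd (cs : seq nat) : cmd :=
  foldr (fun c acc => CSeq acc (push_cmd c)) CSkip cs.

Lemma exec_pushes cs m k p :
  exec (pushes_cmd cs) (nth 0 [:: m; 0; 0; 0; 0; k; p])
                       (nth 0 [:: foldr cpair m cs; 0; 0; 0; 0; k; p]).
Proof.
by elim: cs => [|c cs IH] /=; [constructor | apply: ExSeq IH (exec_push _ _ _ _)].
Qed.

(** The tags are those of [code_ltl]: 3 for [LAnd], 4 for [LNext]. The intended value is the code of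
    a conjunction whose left part is coded by [n] and whose right part is [n] nested nexts over a
    core coded by [c0], inside the context [cs]. *)
Definition selfcode (c0 : nat) (cs : seq nat) (n : nat) : nat :=
  cpair 3 (cpair n (foldr cpair (iter n (cpair 4) c0) cs)).

(** Two copies of [n] are made: register 5 counts the nexts, register 6 keeps [n] to be paired as
    the code of the left conjunct. *)
Definition selfcode_cmd (c0 : nat) (cs : seq nat) : cmd :=
  CSeq (CLoop 0 (CSeq (CInc 5) (CInc 6)))
  (CSeq (incs c0 0)
  (CSeq (CLoop 5 (push_cmd 4))
  (CSeq (pushes_cmd cs)
  (CSeq (CLoop 6 (CInc 1))
  (CSeq pair_cmd (push_cmd 3)))))).

Lemma init_configE n : (init_config n).2 = nth 0 [:: n; 0; 0; 0; 0; 0; 0].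
Proof.
by apply: functional_extensionality => k; do 7!case: k => [//|k]; case: k.
Qed.

(** All scratch registers end at zero, so the decision program can start directly on the result. *)
Lemma exec_selfcode c0 cs n :
  exec (selfcode_cmd c0 cs) (init_config n).2 (init_config (selfcode c0 cs n)).2.
Proof.
rewrite !init_configE /selfcode.
have move056 a b : exec (CLoop 0 (CSeq (CInc 5) (CInc 6)))
    (nth 0 [:: n; 0; 0; 0; 0; a; b]) (nth 0 [:: 0; 0; 0; 0; 0; n + a; n + b]).
  elim: n a b => [|v IH] a b; first by apply: ExLoop0.
  apply: exec_loopS (ExSeq (exec_inc _ _) (exec_inc _ _)) _ => //.
  by rewrite !addSnnS; apply: IH.
have iter5 m b : exec (CLoop 5 (push_cmd 4)) (nth 0 [:: m; 0; 0; 0; 0; n; b])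
    (nth 0 [:: iter n (cpair 4) m; 0; 0; 0; 0; 0; b]).
  elim: n m {move056} => [|v IH] m; first by apply: ExLoop0.
  apply: (exec_loopS (v := v)) => //; first exact: exec_push.
  by rewrite iterSr; apply: IH.
have move61 m a : exec (CLoop 6 (CInc 1)) (nth 0 [:: m; a; 0; 0; 0; 0; n])
    (nth 0 [:: m; n + a; 0; 0; 0; 0; 0]).
  elim: n a {move056 iter5} => [|v IH] a; first by apply: ExLoop0.
  by apply: exec_loopS (exec_inc _ _) _ => //; rewrite addSnnS; apply: IH.
apply: ExSeq (move056 0 0) _; apply: ExSeq (exec_incs0 _ _ _ _ _ _ _ _) _.
rewrite !addn0; apply: ExSeq (iter5 _ _) _; apply: ExSeq (exec_pushes _ _ _ _) _.
apply: ExSeq (move61 _ _) _; rewrite addn0; apply: ExSeq (exec_pair _ _ _ _) _.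
exact: exec_push.
Qed.

(** * The diagonal machine *)

Definition diag_test (P : program) (c : cmd) : nat := csize c + size P.

(* Leaves the program when [P] answers a nonzero value on the number computed by [c], and loops
   forever in an unchanged configuration when it answers zero. *)
Definition diag (P : program) (c : cmd) : seq minstr :=
  compile 0 c ++ relocate P (csize c)
    ++ [:: MI false 0 (diag_test P c).+2 (diag_test P c).+1;
           MI false 0 (diag_test P c).+1 (diag_test P c).+1].

Lemma reach_diag P c n n' m : exec c (init_config n).2 (init_config n').2 ->
  computes_on P n' m ->
  exists2 rho, rho 0 = m &
    reach (diag P c) (init_config n) (diag_test P c, rho).
Proof.
move=> ex [t [halt_t ans]]; exists (iter t (step P) (init_config (n'))).2 => //.
have cD : code_at (diag P c) 0 (diag P c).
  by exists [::], [::]; rewrite cats0.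
move: cD; rewrite {2}/diag => /code_at_cat [cD1 /code_at_cat [cD2 _]].
have := compile_correct ex cD1 => r1.
rewrite add0n in r1; apply: reach_trans r1 _; rewrite add0n size_compile in cD2.
by have := relocate_correct cD2 halt_t; rewrite min0n addn0; apply.
Qed.

Lemma size_diag P c :
  size (diag P c) = (diag_test P c).+2.
Proof. by rewrite /diag !size_cat size_compile size_mkseq /diag_test addnA addn2. Qed.

Lemma nth_diag P c k :
  nth mi_dflt (diag P c) (diag_test P c + k) =
  nth mi_dflt [:: MI false 0 (diag_test P c).+2 (diag_test P c).+1;
                  MI false 0 (diag_test P c).+1
                             (diag_test P c).+1] k.
Proof.
rewrite /diag catA nth_cat size_cat size_compile size_mkseq -/(diag_test P c) ifF; last by lia.
by rewrite addKn.
Qed.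

Lemma diag_nonzero P c n n' m : exec c (init_config n).2 (init_config n').2 ->
  computes_on P n' m.+1 ->
  exists t, size (diag P c) <= (iter t (mstep (diag P c)) (init_config n)).1.
Proof.
move=> ex /(reach_diag ex) [rho rho0 [t e]]; exists t.+1; rewrite iterS e.
rewrite (@mstepE _ _ _ false 0 (diag_test P c).+2
   (diag_test P c).+1); first by rewrite rho0 size_diag.
  by rewrite -{1}[diag_test P c]addn0 nth_diag.
by rewrite size_diag; lia.
Qed.

(** The first closing instruction finds register 0 zero and jumps to the second, which jumps to
    itself; decrementing zero changes nothing. *)
Lemma diag_zero P c n n' : exec c (init_config n).2 (init_config n').2 ->
  computes_on P n' 0 ->
  exists t, let cf := iter t (mstep (diag P c)) (init_config n) in
    cf.1 < size (diag P c) /\ mstep (diag P c) cf = cf.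
Proof.
move=> ex /(reach_diag ex) [rho rho0 [t e]]; exists t.+1; rewrite iterS e.
rewrite (@mstepE _ _ _ false 0 (diag_test P c).+2
   (diag_test P c).+1); first last.
- by rewrite size_diag; lia.
- by rewrite -{1}[diag_test P c]addn0 nth_diag.
rewrite rho0 eqxx upd_id //; split; first by rewrite size_diag /=; lia.
rewrite (@mstepE _ _ _ false 0 (diag_test P c).+1
   (diag_test P c).+1).
- by rewrite rho0 eqxx upd_id.
- by rewrite -{1}addn1 nth_diag.
by rewrite size_diag; lia.
Qed.

(** * Bounds on the registers in use *)

Definition mi_lt (K : nat) (D : seq minstr) : bool := all (fun i => mi_reg i < K) D.

Fixpoint cmd_lt (K : nat) (c : cmd) : bool :=
  match c with
  | CSkip => true
  | CInc r => r < K
  | CSeq c1 c2 => cmd_lt K c1 && cmd_lt K c2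
  | CLoop r c => (r < K) && cmd_lt K c
  end.

Lemma mi_lt_compile K c off : cmd_lt K c -> mi_lt K (compile off c).
Proof.
elim: c off => //= [r|c1 IH1 c2 IH2|r c IH] off.
- by rewrite /mi_lt /= andbT.
- by move=> /andP [/(IH1 off) lt1 /(IH2 (off + csize c1)) lt2]; rewrite /mi_lt all_cat; apply/andP.
- by move=> /andP [lt1 /(IH off.+1) lt2]; rewrite /mi_lt /= all_cat -/(mi_lt K _) lt2 /= lt1.
Qed.

Lemma cmd_lt_widen K K' c : K <= K' -> cmd_lt K c -> cmd_lt K' c.
Proof.
move=> leK; elim: c => //= [r lt|c1 IH1 c2 IH2|r c IH].
- exact: leq_trans lt leK.
- by move=> /andP [/IH1 -> /IH2 ->].
- by move=> /andP [lt /IH ->]; rewrite (leq_trans lt leK).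
Qed.

Lemma cmd_lt_selfcode c0 cs : cmd_lt 7 (selfcode_cmd c0 cs).
Proof.
have incs_lt n r : r < 7 -> cmd_lt 7 (incs n r) by move=> lt; elim: n => //= n ->; rewrite lt.
have pushes_lt : cmd_lt 7 (pushes_cmd cs) by elim: cs => //= c cs ->; rewrite incs_lt.
by rewrite /= pushes_lt !incs_lt.
Qed.

Definition instr_reg (i : instr) : nat := match i with Inc r => r | Dec r _ => r end.

(** The 7 accounts for registers 0 to 6 of [selfcode_cmd]. *)
Definition prog_regs (P : program) : nat := 
  maxn 7 (\max_(k < size P) instr_reg (nth (Inc 0) P k)).+1.

Lemma mi_lt_diag P c : cmd_lt 7 c -> mi_lt (prog_regs P) (diag P c).
Proof.
move=> lt_c; have K7 : 7 <= prog_regs P by rewrite leq_maxl.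
rewrite /mi_lt /diag !all_cat; apply/and3P; split.
- exact: mi_lt_compile (cmd_lt_widen K7 lt_c).
- apply/(all_nthP mi_dflt) => k; rewrite size_mkseq => lt_k.
  rewrite nth_mkseq //.
  have : instr_reg (nth (Inc 0) P k) < prog_regs P.
    rewrite leq_max ltnS; apply/orP; right.
    exact: (leq_bigmax (Ordinal lt_k)).
  by case: nth.
- by rewrite /= !(leq_trans _ K7).
Qed.

(** * Derived LTL operators *)

Definition LFalse {AP : Type} : ltl AP := LNot LTrue.
Definition LOr (AP : Type) (f g : ltl AP) : ltl AP := LNot (LAnd (LNot f) (LNot g)).
Definition LImp (AP : Type) (f g : ltl AP) : ltl AP := LNot (LAnd f (LNot g)).
Definition LGlobally (AP : Type) (f : ltl AP) : ltl AP := LNot (LUntil LTrue (LNot f)).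
Definition LNexts (AP : Type) (n : nat) (f : ltl AP) : ltl AP := iter n (@LNext AP) f.
Definition LLit (AP : Type) (b : bool) (f : ltl AP) : ltl AP := if b then f else LNot f.

Definition LWhile (AP : Type) (f g h : ltl AP) : ltl AP := LNot (LUntil f (LAnd g (LNot h))).

Lemma sat_or (AP : Type) (w : word AP) i f g :
  sat_at w i (LOr f g) <-> sat_at w i f \/ sat_at w i g.
Proof. by rewrite /=; split; [move/not_and_or => [] /NNPP; [left|right] | case=> ? []]. Qed.

Lemma sat_imp (AP : Type) (w : word AP) i f g :
  sat_at w i (LImp f g) <-> (sat_at w i f -> sat_at w i g).
Proof. by rewrite /=; split=> [h hf|h [/h hg]] //; apply: NNPP => hg; apply: h. Qed.

Lemma sat_while (AP : Type) (w : word AP) i f g h :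
  sat_at w i (LWhile f g h) <->
  forall j, i <= j -> (forall k, i <= k -> k < j -> sat_at w k f) ->
    sat_at w j g -> sat_at w j h.
Proof.
split=> /= [nU j ij hf hg|hyp [j ij [[hg nh] hf]]]; last exact/nh/hyp.
by apply: NNPP => nh; apply: nU; exists j.
Qed.

Lemma sat_globally (AP : Type) (w : word AP) i f :
  sat_at w i (LGlobally f) <-> forall j, i <= j -> sat_at w j f.
Proof.
split=> /= [nU j ij|hyp [j ij [nf _]]]; last exact/nf/hyp.
by apply: NNPP => nf; apply: nU; exists j.
Qed.

Lemma sat_nexts (AP : Type) (w : word AP) i n f :
  sat_at w i (LNexts n f) <-> sat_at w (i + n) f.
Proof. by elim: n i => [|n IH] i; rewrite ?addn0 // /LNexts /= IH addSnnS. Qed.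

Lemma sat_bigor (AP : Type) (w : word AP) i n (F : nat -> ltl AP) :
  sat_at w i (foldr (fun q => LOr (F q)) LFalse (iota 0 n)) <->
  exists2 q, q < n & sat_at w i (F q).
Proof.
suff gen m : sat_at w i (foldr (fun q => LOr (F q)) LFalse (iota m n)) <->
    exists2 q, m <= q < m + n & sat_at w i (F q) by exact: gen.
elim: n m => [|n IH] m; rewrite [iota _ _]/= [foldr _ _ _]/=.
  by split=> [[]|[q]] //; rewrite addn0; case: ltngtP.
rewrite sat_or IH addnS addSn; split=> [[h|[q lt h]]|[q lt h]].
- by exists m => //; lia.
- by exists q => //; lia.
- have [eq_qm|lt_mq] := eqVneq q m; first by left; rewrite -eq_qm.
  by right; exists q => //; lia.
Qed.

(** Abstracting from atoms lets a shifted atom [LNexts n f] be treated as a word in its own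
    right. *)
Definition reads (AP : Type) (w : word AP) (f : ltl AP) (v : nat -> bool) : Prop :=
  forall k, sat_at w k f <-> v k.

Lemma reads_nexts (AP : Type) (w : word AP) f v n :
  reads w f v -> reads w (LNexts n f) (fun k => v (k + n)).
Proof. by move=> rf k; rewrite sat_nexts. Qed.

Lemma sat_lit (AP : Type) (w : word AP) f v b p :
  reads w f v -> sat_at w p (LLit b f) <-> v p = b.
Proof. by move=> rf; case: b => /=; rewrite rf //; split=> [/negP/negbTE|->]. Qed.

(** * Words read by LTL formulas *)

Definition prefix_at (v : nat -> bool) (p : nat) (s : seq bool) : Prop :=
  forall k, k < size s -> v (p + k) = nth false s k.

(* From position [p] on, [v] is [s] followed by zeros. *)
Definition follows (v : nat -> bool) (p : nat) (s : seq bool) : Prop :=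
  forall k, v (p + k) = nth false s k.

Lemma follows_cat v p s1 s2 :
  follows v p (s1 ++ s2) <-> prefix_at v p s1 /\ follows v (p + size s1) s2.
Proof.
split=> [h|[h1 h2] k].
  by split=> k => [lt_k|]; rewrite -?addnA h nth_cat ?lt_k // ifF ?addKn //; lia.
rewrite nth_cat; case: ltnP => [lt_k|le_k]; first exact: h1.
by rewrite -h2 -addnA subnKC.
Qed.

Lemma prefix_at_cat v p s1 s2 :
  prefix_at v p (s1 ++ s2) <-> prefix_at v p s1 /\ prefix_at v (p + size s1) s2.
Proof.
split=> [h|[h1 h2] k].
  split=> k lt_k; [have := h k|have := h (size s1 + k)];
    rewrite size_cat nth_cat ?lt_k ?addnA => ->; rewrite ?ifF ?addKn //; lia.
rewrite size_cat nth_cat => lt; case: (ltnP k (size s1)) => le_k; first exact: h1.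
by rewrite -h2 -?addnA ?subnKC //; lia.
Qed.

Lemma prefix_at_cons v p b s :
  prefix_at v p (b :: s) <-> v p = b /\ prefix_at v p.+1 s.
Proof.
rewrite -cat1s prefix_at_cat addn1 /prefix_at /=.
split=> [] [h ?]; split=> //; first by rewrite -[p]addn0 h.
by case=> // _; rewrite addn0.
Qed.

Lemma follows_cons v p b s :
  follows v p (b :: s) <-> v p = b /\ follows v p.+1 s.
Proof.
split=> [h|[h1 h2] [|k]]; last 2 first.
- by rewrite addn0.
- by rewrite -addSnnS h2.
by split=> [|k]; [rewrite -[p]addn0 h | rewrite addSnnS h].
Qed.

Fixpoint LSpell (AP : Type) (f : ltl AP) (s : seq bool) : ltl AP :=
  if s is b :: s' then LAnd (LLit b f) (LNext (LSpell f s')) else LGlobally (LNot f).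

Lemma sat_spell (AP : Type) (w : word AP) f v p s :
  reads w f v -> sat_at w p (LSpell f s) <-> follows v p s.
Proof.
move=> rf; elim: s p => [|b s IH] p.
  rewrite sat_globally; split=> [h k|h j /subnKC <-] /=.
    by rewrite nth_nil; apply/negP => /rf; apply: h; apply: leq_addr.
  by rewrite rf h nth_nil.
by rewrite follows_cons -IH -(sat_lit b p rf).
Qed.

(** With the separator at the end, the first letter tells whether the number is zero, and
    incrementing means prefixing a zero. *)
Definition unary (a : nat) : seq bool := rcons (nseq a false) true.

Definition enc (l : seq nat) : seq bool := flatten (map unary l).
Arguments enc : simpl never.

Lemma enc_cat l1 l2 : enc (l1 ++ l2) = enc l1 ++ enc l2.
Proof. by rewrite /enc map_cat flatten_cat. Qed.

Lemma enc_cons a l : enc (a :: l) = unary a ++ enc l.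
Proof. by []. Qed.

Lemma enc_rcons l a : enc (rcons l a) = enc l ++ unary a.
Proof. by rewrite -cats1 enc_cat /enc /= cats0. Qed.

Lemma follows_encS v p a l s :
  follows v p (enc (a.+1 :: l) ++ s) <-> v p = false /\ follows v (p + 1) (enc (a :: l) ++ s).
Proof. by rewrite !enc_cons follows_cons addn1. Qed.

Lemma prefix_at_unary v p a :
  prefix_at v p (unary a) <-> (forall k, p <= k < p + a -> v k = false) /\ v (p + a).
Proof.
rewrite /unary -cats1 prefix_at_cat prefix_at_cons size_nseq.
split=> [[h [vb _]]|[h vb]]; split=> //.
- move=> k /andP [le_k lt_k]; have := h (k - p).
  by rewrite size_nseq nth_nseq if_same subnKC // => ->; lia.
- by move=> k; rewrite size_nseq => lt_k; rewrite nth_nseq if_same h //; lia.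
Qed.

Lemma follows_unary_inj v p a b : follows v p (unary a) -> follows v p (unary b) -> a = b.
Proof.
suff le a' b' : follows v p (unary a') -> follows v p (unary b') -> a' <= b'.
  by move=> ha hb; apply/eqP; rewrite eqn_leq !le.
move=> ha hb; rewrite leqNgt; apply/negP => lt_ba.
have := ha b'; rewrite hb /unary !nth_rcons !size_nseq !ltnn eqxx lt_ba nth_nseq.
by rewrite if_same.
Qed.

(* [f] and [g] describe the same word up to and including its [r]-th one, where [h] takes over. *)
Fixpoint LAgree (AP : Type) (f g : ltl AP) (r : nat) (h : ltl AP) : ltl AP :=
  if r is r'.+1 then
    LUntil (LAnd (LNot f) (LNot g)) (LAnd (LAnd f g) (LNext (LAgree f g r' h)))
  else h.

(** The until must stop exactly at the first separator of the word read by [g]: earlier [g] is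
    false, and at that separator [g] is true, so the waiting condition fails. *)
Lemma sat_agree (AP : Type) (w : word AP) f g vf vg h p l :
  reads w f vf -> reads w g vg -> prefix_at vg p (enc l) ->
  sat_at w p (LAgree f g (size l) h) <->
  prefix_at vf p (enc l) /\ sat_at w (p + size (enc l)) h.
Proof.
move=> rf rg; elim: l p => [|a l IH] p.
  by rewrite /= addn0; split=> [hh|[]] //; split.
rewrite enc_cons !prefix_at_cat size_cat addnA.
rewrite size_rcons size_nseq addnS => -[ga gl].
rewrite and_assoc -IH // prefix_at_unary.
move/prefix_at_unary: ga => [g0 g1] /=.
split=> [[j le_pj [[[/rf fj /rg gj] hj] hk]]|[[f0 f1] hl]].
  have ej : j = p + a.
    apply/eqP; rewrite eqn_leq; apply/andP; split; rewrite leqNgt; apply/negP => lt.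
    - by have [|_] := hk (p + a) _ lt; [lia | case; apply/rg].
    - by move: gj; rewrite g0 // le_pj.
  rewrite -ej; split; last by rewrite ej in hj *.
  split=> // k /andP [le_k lt_k]; apply/negP => /rf fk.
  by case: (hk k) => // ; lia.
exists (p + a); first exact: leq_addr.
split; first by split=> //; split; [apply/rf | apply/rg].
by move=> k le_k lt_k; rewrite rf rg f0 ?g0 ?le_k.
Qed.

(** * Configurations as words *)

Definition xyz (x y z : nat -> bool) : word prop_xyz :=
  fun k a => match a with px => x k | py => y k | pz => z k end.

Lemma reads_y x y z : reads (xyz x y z) (LAtom py) y. Proof. by []. Qed.
Lemma reads_z x y z : reads (xyz x y z) (LAtom pz) z. Proof. by []. Qed.

(* The program counter comes last, so that the words describing the registers, and hence the
   formulas about the initial configuration, do not depend on the size of the program. *)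
Definition cseq (K : nat) (c : config) : seq bool := enc (rcons (mkseq c.2 K) c.1).

(** The ones close register 0 and encode the zeros in the other [K - 1] registers and in the program
    counter; only zeros follow. *)
Definition LBlock (K : nat) : ltl prop_xyz := LSpell (LAtom py) (nseq K.+1 true).

Lemma cseq_init K n : 0 < K -> cseq K (init_config n) = nseq n false ++ nseq K.+1 true.
Proof.
case: K => // K _; rewrite /cseq; have -> : mkseq (init_config n).2 K.+1 = n :: nseq K 0.
  rewrite /mkseq [map _ _]/=; congr (_ :: _); apply: (@eq_from_nth _ 0).
    by rewrite size_map size_iota size_nseq.
  move=> i; rewrite size_map size_iota => lt_i.
  by rewrite (nth_map 0) ?size_iota // nth_iota // nth_nseq lt_i.
rewrite [rcons _ _]/= enc_cons /unary -cats1 -catA; congr (_ ++ _).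
have -> : rcons (nseq K 0) 0 = nseq K.+1 0 by elim: K => //= K ->.
by rewrite /enc /=; congr [:: _, _ & _]; elim: K => //= K ->.
Qed.

(** The description is split so that [n] occurs only as a distance in the second conjunct: the first
    one, free of [n], says that zeros precede the block. *)
Lemma sat_init x y z K n p : 0 < K ->
  sat_at (xyz x y z) p (LUntil (LNot (LAtom py)) (LBlock K)) /\
  sat_at (xyz x y z) (p + n) (LBlock K) <->
  follows y p (cseq K (init_config n)).
Proof.
move=> K0; rewrite cseq_init // follows_cat size_nseq.
have spell j : sat_at (xyz x y z) j (LBlock K) <-> follows y j (nseq K.+1 true).
  exact/sat_spell/reads_y.
have one j k : follows y j (nseq K.+1 true) -> y (j + k) = (k < K.+1).
  by move=> ->; rewrite nth_nseq; case: ifP.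
rewrite spell; split=> [[[j le_pj [/spell hj hk]] hn]|[h0 hn]].
  (* The block has only one possible start: it begins with a one, which forbids a later [j], and its
     last one at [p + n + K] would fall in the zeros after a block at an earlier [j]. *)
  have ej : j = p + n.
    apply/eqP; rewrite eqn_leq; apply/andP; split; rewrite leqNgt; apply/negP => lt.
    - apply: (hk (p + n)); rewrite ?leq_addr //=.
      by rewrite -[p + n]addn0 (one _ 0 hn).
    - have := one _ K hn; rewrite ltnSn -{1}(subnKC (ltnW lt)) -addnA (one j) //.
      by lia.
  split=> // k; rewrite size_nseq => lt_k; rewrite nth_nseq if_same.
  by apply/negP/(hk (p + k)); rewrite ?leq_addr //; lia.
split=> //; exists (p + n); first exact: leq_addr.
split=> [|k le_k lt_k]; first exact/spell.
have := h0 (k - p); rewrite size_nseq nth_nseq if_same subnKC //= => -> //; lia.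
Qed.

(* A word [y] starting [a] positions ahead repeats a word [z] starting [b] positions ahead, except
   that the last of the [k + 1] numbers it encodes changes from [q] to [q']. *)
Definition LMove (a b k q q' : nat) : ltl prop_xyz :=
  LAgree (LNexts a (LAtom py)) (LNexts b (LAtom pz)) k
    (LAnd (LNexts a (LSpell (LAtom py) (unary q'))) (LNexts b (LSpell (LAtom pz) (unary q)))).

Lemma prefix_at_shift v a p s : prefix_at (fun k => v (k + a)) p s <-> prefix_at v (p + a) s.
Proof. by split=> h k /h; rewrite addnAC. Qed.

Lemma sat_move x y z a b p l q q' q0 : follows z (p + b) (enc l ++ unary q0) ->
  sat_at (xyz x y z) p (LMove a b (size l) q q') <->
  q = q0 /\ follows y (p + a) (enc l ++ unary q').
Proof.
move=> /follows_cat [zl zq].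
have ry := reads_nexts a (@reads_y x y z); have rz := reads_nexts b (@reads_z x y z).
rewrite (sat_agree _ ry rz) ?prefix_at_shift // follows_cat [sat_at _ _ (LAnd _ _)]/=.
rewrite !sat_nexts (sat_spell _ _ (@reads_y x y z)) (sat_spell _ _ (@reads_z x y z)).
rewrite ![_ + size (enc l) + _]addnAC.
by split=> [[yl [yq /(follows_unary_inj zq) ->]]|[-> [yl yq]]].
Qed.

(* The step of the instruction [MI b r q' q'] (when [zero] tells whether register [r] is zero) from
   state [q]; the word [z] of the old configuration is one position late. *)
Definition LBranch (K : nat) (b : bool) (r q q' : nat) (zero : bool) : ltl prop_xyz :=
  LAgree (LAtom py) (LNexts 1 (LAtom pz)) r
    (LAnd (LLit zero (LNexts 1 (LAtom pz)))
       (if b then LAnd (LNot (LAtom py)) (LMove 1 1 (K - r) q q')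
        else LMove 0 (if zero then 1 else 2) (K - r) q q')).

Lemma mkseq_upd (rho : nat -> nat) r K : r < K ->
  exists l1 l2, [/\ size l1 = r, size l2 = K - r.+1 &
    forall v, mkseq (upd rho r v) K = l1 ++ v :: l2].
Proof.
move=> lt_rK; exists (mkseq rho r), (map rho (iota r.+1 (K - r.+1))).
split=> [||v]; rewrite ?size_mkseq ?size_map ?size_iota //.
rewrite /mkseq -{1}(subnKC lt_rK) addSnnS iotaD map_cat /= updE eqxx.
congr (_ ++ _ :: _); apply/eq_in_map => k; rewrite mem_iota updE => lt_k;
  by rewrite ifF //; lia.
Qed.

(** Up to register [r], [z] lags by one. An increment puts an extra zero into [y], after which both
    words are read at offset 1; a decrement of a nonzero register drops a zero, so [z] lags by two;
    a decrement of zero keeps the lag of one. *)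
Lemma sat_branch x y z p K b r q q0 q' rho zero : r < K ->
  follows z p.+1 (cseq K (q0, rho)) ->
  sat_at (xyz x y z) p (LBranch K b r q q' zero) <->
  q = q0 /\ zero = (rho r == 0) /\
  follows y p (cseq K (q', upd rho r (if b then (rho r).+1 else (rho r).-1))).
Proof.
move=> lt_rK; have [l1 [l2 [sz1 sz2 updl]]] := mkseq_upd rho lt_rK.
rewrite /cseq !enc_rcons /= updl -{1}(@upd_id rho r (rho r)) // updl.
rewrite !enc_cat -!(catA (enc l1)) -addn1 => zf; rewrite follows_cat.
have [zl1 zl2] := (follows_cat _ _ _ _).1 zf.
have rz := reads_nexts 1 (@reads_z x y z).
have zl1' : prefix_at (fun k => z (k + 1)) p (enc l1) by apply/prefix_at_shift.
rewrite /LBranch -{1}sz1 (sat_agree _ (@reads_y x y z) rz zl1') [sat_at _ _ (LAnd _ _)]/=.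
rewrite (sat_lit _ _ rz).
set P := p + size (enc l1) in zl2 *; rewrite addnAC -/P in zl2.
have -> : z (P + 1) = (rho r == 0).
  have := zl2 0; rewrite addn0 => ->.
  by rewrite enc_cons /unary; case: (rho r).
have szl v : K - r = size (v :: l2) by rewrite /= sz2; lia.
suff main : zero = (rho r == 0) ->
  sat_at (xyz x y z) P (if b then LAnd (LNot (LAtom py)) (LMove 1 1 (K - r) q q')
                        else LMove 0 (if zero then 1 else 2) (K - r) q q') <->
  q = q0 /\ follows y P (enc ((if b then (rho r).+1 else (rho r).-1) :: l2) ++ unary q').
  split=> [[yl [/esym zr]]|[eq [zr [yl yf]]]]; first by move/(main zr) => [].
  by split=> //; split=> //; apply/(main zr).
move=> ->; case: b.
  rewrite [sat_at _ _ _]/= (szl (rho r)) (sat_move _ _ _ _ _ zl2) follows_encS.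
  by split=> [[/negP/negbTE yP [eq yf]]|[eq [yP yf]]]; rewrite ?yP.
move: zl2; case: (rho r) => [|v] zl2; rewrite ?eqxx.
  by rewrite (szl 0) (sat_move _ _ _ _ _ zl2) addn0.
have {}zl2 : follows z (P + 2) (enc (v :: l2) ++ unary q0).
  by move: zl2; rewrite follows_encS -addnA => -[].
by rewrite (szl v) (sat_move _ _ _ _ _ zl2) addn0.
Qed.

Definition LInstr (K q : nat) (i : minstr) : ltl prop_xyz :=
  let: MI b r q1 q0 := i in LOr (LBranch K b r q q0 true) (LBranch K b r q q1 false).

Lemma sat_instr x y z p K q q0 rho i : mi_reg i < K ->
  follows z p.+1 (cseq K (q0, rho)) ->
  sat_at (xyz x y z) p (LInstr K q i) <->
  q = q0 /\ follows y p (cseq K (mi_step i rho)).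
Proof.
case: i => b r q1 q2 lt_r zf.
rewrite /LInstr sat_or !(sat_branch _ _ _ _ _ _ lt_r zf) /mi_step.
by case: eqP => r0; split=> [[] [? []]|[]] //; [left|right].
Qed.

Definition LStep (K : nat) (D : seq minstr) : ltl prop_xyz :=
  foldr (fun q => LOr (LInstr K q (nth mi_dflt D q))) LFalse (iota 0 (size D)).

(** No disjunct matches a counter outside the program, so leaving the program makes the formula
    false: halting becomes unrealizability. *)
Lemma sat_step x y z p K D c : mi_lt K D ->
  follows z p.+1 (cseq K c) ->
  sat_at (xyz x y z) p (LStep K D) <->
  c.1 < size D /\ follows y p (cseq K (mstep D c)).
Proof.
case: c => q0 rho /(all_nthP mi_dflt) lt_reg zf; rewrite sat_bigor /mstep [_.1]/=.
split=> [[q lt_q]|[lt_q]].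
  by rewrite (sat_instr _ _ _ (lt_reg q lt_q) zf) => -[<- yf]; rewrite lt_q.
rewrite lt_q => yf; exists q0 => //.
by rewrite (sat_instr _ _ _ (lt_reg q0 lt_q) zf).
Qed.

(** * The specification *)

(** Anchors [h] at the first one of the input; an input of zeros only is unconstrained. *)
Definition LRise (h : ltl prop_xyz) : ltl prop_xyz :=
  LWhile (LNot (LAtom px)) (LAtom px) h.

(* Everything except the value of the first register in the initial configuration, which must stay
   outside because it will be the code of this formula. *)
Definition machine_formula (K : nat) (D : seq minstr) : ltl prop_xyz :=
  let x := LAtom px in let y := LAtom py in
  LAnd (LWhile (LNot x) LTrue (LNot y))
  (LAnd (LRise (LNext (LNot y)))
  (LAnd (LRise (LWhile x (LAnd x (LNext x)) (LNexts 2 y)))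
  (LAnd (LRise (LWhile x (LNot x) (LNext (LNot y))))
  (LAnd (LRise (LNext (LImp (LNot x) (LNexts 2 (LUntil (LNot y) (LBlock K))))))
        (LRise (LNext (LImp x (LWhile x (LNot x) (LNexts 2 (LStep K D)))))))))).

(** The nexts counting [n] are nested around a fixed formula, so that the code is obtained by
    iterating [cpair 4]. *)
Definition input_formula (K n : nat) : ltl prop_xyz :=
  LRise (LNext (LImp (LNot (LAtom px)) (LNexts n (LNexts 2 (LBlock K))))).

(** On the way down to the nested nexts one always enters the right component of a pair, so the
    context is the list of left components: tags and codes of left subformulas. *)
Definition input_context : seq nat :=
  let nx := code_ltl (LNot (LAtom px)) in
  [:: 2; 5; nx; 3; code_ltl (LAtom px); 2; 4; 2; 3; nx; 2].

Lemma code_input K n :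
  code_ltl (input_formula K n) =
  foldr cpair (iter n (cpair 4) (code_ltl (LNexts 2 (LBlock K)))) input_context.
Proof.
have <- : code_ltl (LNexts n (LNexts 2 (LBlock K))) =
    iter n (cpair 4) (code_ltl (LNexts 2 (LBlock K))).
  by rewrite {1}/LNexts; elim: n => // n IH; rewrite !iterS -IH.
by [].
Qed.

(** Nothing is said of [x (s + i)]: the number [i] is only a lower bound for the length of the
    pulse. *)
Definition pulse (x : nat -> bool) (s i : nat) : Prop :=
  (forall k, k < s -> x k = false) /\ (forall k, s <= k < s + i -> x k).

Lemma pulse_le x s i j : i <= j -> pulse x s j -> pulse x s i.
Proof. by move=> le_ij [h0 h1]; split=> // k lt_k; apply: h1; lia. Qed.

Lemma pulseS x s i : pulse x s i.+1 <-> pulse x s i /\ x (s + i).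
Proof.
split=> [h|[[h0 h1] xi]]; first by split; [exact: pulse_le h | apply: h.2; lia].
split=> // k lt_k; have [->//|ne] := eqVneq k (s + i).
by apply: h1; lia.
Qed.

Lemma sat_rise x y z h :
  sat_at (xyz x y z) 0 (LRise h) <->
  forall s, pulse x s 1 -> sat_at (xyz x y z) s h.
Proof.
rewrite sat_while; split=> [hyp s [h0 h1]|hyp s _ h0 h1].
  apply: hyp => //= [k _ /h0 -> //|]; by apply: h1; lia.
apply: hyp; split=> [k lt_k|k lt_k]; first exact/negP/(h0 k).
by have -> : k = s by lia.
Qed.

Lemma sat_rise_while x y z g h :
  sat_at (xyz x y z) 0 (LRise (LWhile (LAtom px) g h)) <->
  forall s i, pulse x s 1 -> pulse x s i ->
    sat_at (xyz x y z) (s + i) g -> sat_at (xyz x y z) (s + i) h.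
Proof.
rewrite sat_rise; split=> [hyp s i ps1 psi|hyp s ps1].
  have /sat_while := hyp s ps1; apply; first exact: leq_addr.
  by move=> k le_k lt_k; apply: psi.2; rewrite le_k.
apply/sat_while => j /subnKC <- hx; apply: hyp => //.
by split=> [|k /andP [le_k lt_k]]; [exact: ps1.1 | exact: hx].
Qed.

(* [y] answers a pulse of [i + 1] ones by a pulse of [i] ones that starts two steps later. *)
Definition delays (x y : nat -> bool) : Prop :=
  [/\ forall k, (forall j, j < k -> x j = false) -> y k = false,
      forall s, pulse x s 1 -> y s.+1 = false,
      forall s i, pulse x s i.+2 -> y (s + i.+2) &
      forall s i, pulse x s i.+1 -> x (s + i.+1) = false -> y (s + i.+2) = false].

Definition starts (K n : nat) (x y : nat -> bool) : Prop :=
  forall s, pulse x s 1 -> x s.+1 = false -> follows y (s + 3) (cseq K (init_config n)).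

(** The new configuration begins in [y] at [s + i + 4]. The pulse of [y] starts at [s + 2] with
    [i + 1] ones, so the old configuration begins in [z] at [s + i + 5], one position late as
    [LStep] expects. *)
Definition steps (K : nat) (D : seq minstr) (x y z : nat -> bool) : Prop :=
  forall s i, pulse x s i.+2 -> x (s + i.+2) = false ->
    sat_at (xyz x y z) (s + i + 4) (LStep K D).

Lemma sat_spec x y z K D n : 0 < K ->
  ltl_sat (xyz x y z) (LAnd (machine_formula K D) (input_formula K n)) <->
  [/\ delays x y, starts K n x y & steps K D x y z].
Proof.
move=> K0; have satN w f k : sat_at w k (LNot f) <-> ~ sat_at w k f by [].
have satX w f k : sat_at w k (LNext f) <-> sat_at w k.+1 f by [].
have satA w f g k : sat_at w k (LAnd f g) <-> sat_at w k f /\ sat_at w k g by [].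
rewrite /ltl_sat !satA.
have -> : sat_at (xyz x y z) 0 (LWhile (LNot (LAtom px)) LTrue (LNot (LAtom py))) <->
    forall k, (forall j, j < k -> x j = false) -> y k = false.
  rewrite sat_while; split=> [h k x0|h k _ x0 _].
    by apply/negP/(h k) => // j _ /x0 /= ->.
  by rewrite /= h // => j lt_j; apply/negP/(x0 j).
have -> : sat_at (xyz x y z) 0 (LRise (LNext (LNot (LAtom py)))) <->
    forall s, pulse x s 1 -> y s.+1 = false.
  by rewrite sat_rise; split=> h s /h /=; [move/negP/negbTE | move->].
have -> : sat_at (xyz x y z) 0 (LRise (LWhile (LAtom px)
      (LAnd (LAtom px) (LNext (LAtom px))) (LNexts 2 (LAtom py)))) <->
    forall s i, pulse x s i.+2 -> y (s + i.+2).
  rewrite sat_rise_while; split=> [h s i ps|h s i ps1 psi [x1 x2]].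
    have [psi x2] := (pulseS _ _ _).1 ps; have [psi' x1] := (pulseS _ _ _).1 psi.
    rewrite !addnS; apply: (h s i) => //.
      exact: pulse_le psi.
    by split=> //=; rewrite -addnS.
  rewrite sat_nexts -addnA addn2; apply: h.
  by apply/pulseS; split; [apply/pulseS | rewrite addnS].
have -> : sat_at (xyz x y z) 0 (LRise (LWhile (LAtom px) (LNot (LAtom px))
      (LNext (LNot (LAtom py))))) <->
    forall s i, pulse x s i.+1 -> x (s + i.+1) = false -> y (s + i.+2) = false.
  rewrite sat_rise_while; split=> [h s i ps x0|h s [|i] ps1 psi /negP/negbTE x0].
  - rewrite addnS; apply/negP/(h s i.+1) => //; first exact: pulse_le ps.
    by rewrite /= x0.
  - by move: x0; rewrite addn0 ps1.2 //; lia.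
  - by rewrite /= -addnS h.
have imp0 h : sat_at (xyz x y z) 0 (LRise (LNext (LImp (LNot (LAtom px)) h))) <->
    forall s, pulse x s 1 -> x s.+1 = false -> sat_at (xyz x y z) s.+1 h.
  rewrite sat_rise; split=> [hyp s ps x0|hyp s ps]; rewrite ?satX.
    have := hyp s ps; rewrite satX sat_imp; apply.
    by rewrite /= x0.
  by apply/sat_imp => /negP/negbTE; apply: hyp.
rewrite !imp0.
have -> : sat_at (xyz x y z) 0 (LRise (LNext (LImp (LAtom px) (LWhile (LAtom px)
      (LNot (LAtom px)) (LNexts 2 (LStep K D)))))) <-> steps K D x y z.
  rewrite sat_rise; split=> [h s i ps x0|h s ps1]; rewrite ?satX.
    have := h s (pulse_le _ ps); rewrite satX sat_imp sat_while => /(_ isT).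
    have x1 : x s.+1 by apply: ps.2; lia.
    move=> /(_ x1 (s + i.+2)); rewrite sat_nexts -addnA addnS => h'.
    have -> : s + i + 4 = s + (i.+2 + 2) by lia.
    by apply: h'; [lia | move=> k le_k lt_k; apply: ps.2; lia | rewrite /= -addnS x0].
  apply/sat_imp => x1; apply/sat_while => j le_j ones /negP/negbTE x0.
  have ne : j != s.+1 by apply: contraFneq x0 => ->.
  have ej : j = s + (j - s.+2).+2 by lia.
  rewrite sat_nexts ej.
  have -> : s + (j - s.+2).+2 + 2 = s + (j - s.+2) + 4 by lia.
  apply: h; last by rewrite -ej.
  split=> [k|k lt_k]; first exact: ps1.1.
  have [->|nk] := eqVneq k s; first by apply: ps1.2; lia.
  by apply: ones; lia.
have e2 s : s.+1 + 2 = s + 3 by lia.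
have e2n s : s.+1 + n + 2 = s + 3 + n by lia.
split=> [[[d1 [d2 [d3 [d4 [s5 s6]]]]] sa]|[[d1 d2 d3 d4] st s6]].
  split=> // s ps x0; have := sa s ps x0; have := s5 s ps x0.
  by rewrite !sat_nexts e2 e2n => hu hb; apply/(sat_init x y z n (s + 3) K0).
have st' s := (sat_init x y z n (s + 3) K0).2.
split=> [|s ps x0]; last first.
  by rewrite !sat_nexts e2n; apply: (st' s _).2; apply: st.
do 5!split=> //; move=> s ps x0.
by rewrite sat_nexts e2; apply: (st' s _).1; apply: st.
Qed.

(** * Systems over S0 as iterated Moore transductions *)

Fixpoint run (M : moore unit unit) (x : nat -> bool) (k : nat) : mstate M :=
  if k is k'.+1 then mdelta (run M x k') (fun=> x k') else minit M.

Definition resp (M : moore unit unit) (x : nat -> bool) (k : nat) : bool :=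
  mout (run M x k) tt.

Lemma sat_map (A B : Type) (m : A -> B) (w : word B) i f :
  sat_at w i (ltl_map m f) <-> sat_at (fun k a => w k (m a)) i f.
Proof.
elim: f i => //= [f IH|f IHf g IHg|f IHf g IHg] i.
- by rewrite IH.
- by rewrite IHf IHg.
- split=> -[j le_j [hg hf]]; exists j => //; split; try exact/IHg.
    by move=> k le_k lt_k; apply/IHf/hf.
  by move=> k le_k lt_k; apply/IHf/hf.
Qed.

Lemma sat_ext (A : Type) (w w' : word A) i f :
  (forall k a, w k a <-> w' k a) -> sat_at w i f <-> sat_at w' i f.
Proof.
move=> e; elim: f i => //= [f IH|f IHf g IHg|f IHf g IHg] i.
- by rewrite IH.
- by rewrite IHf IHg.
- split=> -[j le_j [hg hf]]; exists j => //; split; try exact/IHg.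
    by move=> k le_k lt_k; apply/IHf/hf.
  by move=> k le_k lt_k; apply/IHf/hf.
Qed.

Lemma sig_true_sy (M : moore unit unit) (f : @cstate unit unit S0 M) :
  sig_true f sy = mout (f ord0) tt.
Proof.
apply/existsP/idP => [[p /existsP [[] /andP []]]|h]; last first.
  by exists ord0; apply/existsP; exists tt.
rewrite /= /S0_eout; case p0: (val p == 0) => // _.
by have -> : p = ord0 by apply/val_inj/eqP.
Qed.

Lemma sig_true_sz (M : moore unit unit) (f : @cstate unit unit S0 M) :
  sig_true f sz = mout (f ord_max) tt.
Proof.
apply/existsP/idP => [[p /existsP [[] /andP []]]|h]; last first.
  by exists ord_max; apply/existsP; exists tt.
rewrite /= /S0_eout; case p0: (val p == 0) => // _.
by have -> : p = ord_max by apply: val_inj; case: p p0 => [[|[|]]].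
Qed.

Lemma cstates_S0 (M : moore unit unit) (inp : nat -> unit -> bool) k :
  let x k := inp k tt in
  @cstates unit unit S0 M inp k ord0 = run M x k /\
  @cstates unit unit S0 M inp k ord_max = run M (resp M x) k.
Proof.
move=> x; elim: k => [|k [IH0 IH1]]; first by [].
by rewrite /= /cstep /= sig_true_sy IH0 IH1.
Qed.

(** Process 1 reads the output of process 0 and runs the same machine, so [z] arises by applying the
    causal map [resp M] twice. *)
Lemma realizableE phi :
  S0_realizable phi <->
  exists M, forall x, ltl_sat (xyz x (resp M x) (resp M (resp M x))) phi.
Proof.
suff eqv M inp : ltl_sat (@ctrace unit unit S0 M inp) (ltl_map xyz_to_S0 phi) <->
    let x k := inp k tt in ltl_sat (xyz x (resp M x) (resp M (resp M x))) phi.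
  split=> -[M h]; exists M; first by move=> x; apply: (eqv M (fun k _ => x k)).1.
  by move=> inp; apply/eqv.
rewrite /ltl_sat sat_map; apply: sat_ext => k [] //=.
- by rewrite sig_true_sy (cstates_S0 M inp k).1.
- by rewrite sig_true_sz (cstates_S0 M inp k).2.
Qed.

(** * Realizability and the diagonal machine *)

(** The counter drops by one from [x] to [y], which drives the induction on counters. *)
Lemma delays_pulse x y s i : delays x y ->
  pulse x s i.+2 -> x (s + i.+2) = false ->
  pulse y (s + 2) i.+1 /\ y (s + 2 + i.+1) = false.
Proof.
move=> [d1 d2 d3 d4] ps x0; split; last first.
  by rewrite -(d4 s i.+1) //; congr y; lia.
split=> k lt_k.
  have [->|ne] := eqVneq k s.+1; first by apply: d2; apply: pulse_le ps.
  by apply: d1 => j lt_j; apply: ps.1; lia.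
have -> : k = s + (k - s.+2).+2 by lia.
by apply: d3; apply: pulse_le ps; lia.
Qed.

Definition tracks (K : nat) (D : seq minstr) (c : config) (x y : nat -> bool) : Prop :=
  forall s i, pulse x s i.+1 -> x (s + i.+1) = false ->
    follows y (s + i + 3) (cseq K (iter i (mstep D) c)).

(* Since the constraint for [x] is also imposed for the input [resp M x], whose counter is smaller,
   induction on the counter determines the answer completely. *)
Lemma realizer_tracks K D n M : mi_lt K D -> 0 < K ->
  (forall x, ltl_sat (xyz x (resp M x) (resp M (resp M x)))
                     (LAnd (machine_formula K D) (input_formula K n))) ->
  forall i x s, pulse x s i.+1 -> x (s + i.+1) = false ->
    follows (resp M x) (s + i + 3) (cseq K (iter i (mstep D) (init_config n))) /\
    (0 < i -> (iter i.-1 (mstep D) (init_config n)).1 < size D).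
Proof.
move=> ltK K0 real; elim=> [|i IH] x s ps x0.
  have [_ st _] := (sat_spec _ _ _ _ _ K0).1 (real x).
  by split=> //; rewrite addn0; apply: st; rewrite // -addn1.
have [dl _ sp] := (sat_spec _ _ _ _ _ K0).1 (real x).
have [py y0] := delays_pulse dl ps x0.
have [zf _] := IH _ _ py y0.
have {}zf : follows (resp M (resp M x)) (s + i + 4).+1
    (cseq K (iter i (mstep D) (init_config n))).
  by have -> : (s + i + 4).+1 = s + 2 + i + 3 by lia.
have [lt yf] := (sat_step _ _ ltK zf).1 (sp s i ps x0).
by split=> //; have -> : s + i.+1 + 3 = s + i + 4 by lia.
Qed.

Lemma realizable_in_program K D n : mi_lt K D -> 0 < K ->
  S0_realizable (LAnd (machine_formula K D) (input_formula K n)) ->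
  forall t, (iter t (mstep D) (init_config n)).1 < size D.
Proof.
move=> ltK K0 /realizableE [M real] t.
(* An input of [t + 2] ones has counter [t + 1], whose predecessor configuration is the one at time
   [t]. *)
have [||_] := @realizer_tracks K D n M ltK K0 real t.+1 (fun k => k < t.+2) 0; last exact.
  by split=> // k; lia.
by rewrite add0n ltnn.
Qed.

(** Using the hypothesis for the input [resp M x] too locates the preceding configuration in [z],
    one position late. *)
Lemma realizable_of_tracks K D n M : mi_lt K D -> 0 < K ->
  (forall t, (iter t (mstep D) (init_config n)).1 < size D) ->
  (forall x, delays x (resp M x) /\ tracks K D (init_config n) x (resp M x)) ->
  S0_realizable (LAnd (machine_formula K D) (input_formula K n)).
Proof.
move=> ltK K0 pcs tr; apply/realizableE; exists M => x.
have [dl trx] := tr x; have [_ try] := tr (resp M x).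
apply/sat_spec => //; split=> // [s ps x0|s i ps x0].
  by have := trx s 0; rewrite addn0 addn1; apply.
have [py y0] := delays_pulse dl ps x0.
have zf : follows (resp M (resp M x)) (s + i + 4).+1
    (cseq K (iter i (mstep D) (init_config n))).
  by have := try _ _ py y0; have -> : s + 2 + i + 3 = (s + i + 4).+1 by lia.
apply/(sat_step _ _ ltK zf); split=> //.
by have := trx _ _ ps x0; have -> : s + i.+1 + 3 = s + i + 4 by lia.
Qed.

(* A finite machine for a computation that becomes stationary after [T] steps: it counts the leading
   ones of its input up to [T + 1], then spells out the corresponding configuration, whose nonzero
   part has length less than [L]. *)
Definition finite_machine (T L : nat) (word_of : nat -> seq bool) : moore unit unit :=
  @Moore unit unit ('I_T.+2 + 'I_T.+1 * 'I_L.+1)%type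
    (fun q a => match q with
       | inl j => if a tt then inl (inord (minn j.+1 T.+1))
                  else if val j == 0 then inl ord0 else inr (inord j.-1, ord0)
       | inr (m, k) => inr (m, inord (minn k.+1 L))
       end)
    (inl ord0)
    (fun q _ => match q with
       | inl j => 1 < j
       | inr (m, k) => nth false (false :: word_of m) k
       end).

Section FiniteMachine.

Variables (T L : nat) (word_of : nat -> seq bool).
Hypothesis T_gt0 : 0 < T.
Hypothesis size_word : forall m, m <= T -> size (word_of m) < L.

Let M := finite_machine T L word_of.

Lemma run_pulse x s i : pulse x s i -> run M x (s + i) = inl (inord (minn i T.+1)).
Proof.
elim: i => [|i IH] ps.
  rewrite addn0 min0n; have -> : inord 0 = ord0 :> 'I_T.+2 by apply: val_inj; rewrite /= inordK.
  elim: s {ps}(ps.1) => [|s IHs] x0 //=.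
  by rewrite IHs => [|k lt_k]; rewrite /= x0 //; lia.
have [psi xi] := (pulseS _ _ _).1 ps.
rewrite addnS /= IH // xi; congr (inl (inord _)).
by rewrite inordK; lia.
Qed.

Lemma run_emit x s i k : pulse x s i.+1 -> x (s + i.+1) = false ->
  run M x (s + i.+2 + k) = inr (inord (minn i T), inord (minn k L)).
Proof.
move=> ps x0; elim: k => [|k IH].
  rewrite addn0 addnS /= run_pulse // x0 /= inordK; last by lia.
  rewrite ifF; last by lia.
  congr (inr (inord _, _)); first by lia.
  by apply: val_inj; rewrite /= min0n inordK.
rewrite addnS /= IH /=; congr (inr (_, inord _)).
by rewrite inordK; lia.
Qed.

Lemma resp_emit x s i k : pulse x s i.+1 -> x (s + i.+1) = false ->
  resp M x (s + i.+2 + k) = nth false (false :: word_of (minn i T)) k.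
Proof.
move=> ps x0; rewrite /resp run_emit // [mout _ _]/=.
have szw := size_word (geq_minr i T).
rewrite !inordK; [| lia | lia].
(* The index saturates at [L], already past the word and its leading zero, so both sides are the
   default zero. *)
case: (leqP k L) => // lt_k.
by rewrite !nth_default //=; lia.
Qed.

Lemma finite_machine_delays x : delays x (resp M x).
Proof.
have pulse_out s i : pulse x s i -> resp M x (s + i) = (1 < i).
  move=> ps; rewrite /resp run_pulse //= inordK; last by lia.
  (* The counter saturates at [T + 1], which exceeds 1 since [T] is positive. *)
  by rewrite leq_min ltnS T_gt0 andbT.
split=> [k x0|s ps|s i ps|s i ps x0].
- by rewrite -[k]addn0 pulse_out //; split=> // j; lia.
- by rewrite -addn1 pulse_out.
- by rewrite pulse_out.
- by rewrite -[s + i.+2]addn0 resp_emit.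
Qed.

Lemma finite_machine_follows x s i : pulse x s i.+1 -> x (s + i.+1) = false ->
  follows (resp M x) (s + i + 3) (word_of (minn i T)).
Proof.
move=> ps x0 k; have -> : s + i + 3 + k = s + i.+2 + k.+1 by lia.
by rewrite resp_emit.
Qed.

End FiniteMachine.

Lemma realizable_of_stationary K D n T : mi_lt K D -> 0 < K ->
  let c := iter T (mstep D) (init_config n) in
  c.1 < size D -> mstep D c = c ->
  S0_realizable (LAnd (machine_formula K D) (input_formula K n)).
Proof.
move=> ltK K0; set conf := fun t => iter t (mstep D) (init_config n).
move=> /= lt_c fix_c.
have later t : conf (t + T) = conf T by rewrite /conf iterD iter_fix.
pose word_of t := cseq K (conf t).
pose L := (\max_(m < T.+2) size (word_of m)).+1.
(* [T.+1] instead of [T] provides the positive bound that the finite machine requires. *)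
apply: (@realizable_of_tracks K D n (finite_machine T.+1 L word_of)) => // [t|x].
  (* A configuration outside the program never changes, so [conf (t + T)], which equals [conf T],
     would lie outside. *)
  rewrite ltnNge; apply/negP => le_t.
  have fix_t : mstep D (conf t) = conf t.
    by move: le_t; rewrite -/(conf t); case: (conf t) => q rho /= le_q; rewrite ltnNge le_q.
  move: lt_c; rewrite -/(conf T) -(later t) addnC /conf iterD iter_fix //.
  by rewrite ltnNge le_t.
have size_word m : m <= T.+1 -> size (word_of m) < L.
  by move=> le_m; rewrite ltnS (leq_bigmax (Ordinal (le_m : m < T.+2))).
split; first exact: finite_machine_delays.
move=> s i ps x0; rewrite -/(conf i).
have -> : conf i = conf (minn i T.+1).
  case: (leqP i T.+1) => // lt_i.
  by rewrite -(subnK (ltnW (ltnW lt_i))) later -[T.+1]add1n later.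
exact: finite_machine_follows.
Qed.

Theorem theorem14 : ~ ltl_decidable S0_realizable.
Proof.
move=> [P decides].
(* The order avoids circularity: [K] depends on [P] alone, [c] on the code of a formula built from
   [K], [D] on [P] and [c], and only then is [n] the code of a formula built from [D]. *)
pose K := prog_regs P.
pose c := selfcode_cmd (code_ltl (LNexts 2 (LBlock K))) input_context.
pose D := diag P c.
pose n := code_ltl (machine_formula K D).
pose phi := LAnd (machine_formula K D) (input_formula K n).
have code_phi : code_ltl phi =
    selfcode (code_ltl (LNexts 2 (LBlock K))) input_context n.
  by rewrite /selfcode -code_input.
have ex : exec c (init_config n).2 (init_config (code_ltl phi)).2.
  by rewrite code_phi; apply: exec_selfcode.
have ltK : mi_lt K D by apply: mi_lt_diag; apply: cmd_lt_selfcode.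
have K0 : 0 < K by apply: leq_trans (leq_maxl _ _).
have [yes no] := decides phi.
have not_real : ~ S0_realizable phi.
  move=> real; have [t] := diag_nonzero ex (yes real).
  by rewrite leqNgt (realizable_in_program ltK K0 real).
have [t [lt_t fix_t]] := diag_zero ex (no not_real).
exact: not_real (realizable_of_stationary ltK K0 lt_t fix_t).
Qed.
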